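(* Let $\mathcal C$ be a semi-abelian variety of universal algebras, let $A$ be an object of $\mathcal C$, and consider the $A$-nullification functor $P_A$ on $\mathcal C$. Assume that $P_A$ admits a functorial fiberwise localization. Then $P_A$ is semi-left-exact. In particular $P_A$ is conditionally flat.
   Context: A variety of universal algebras is a finitary equational class (sets equipped with finitary operations satisfying a set of identities), regarded as a category with the homomorphisms as morphisms. It is semi-abelian if it is a semi-abelian category; equivalently, its algebraic theory has a unique constant $0$ and, for some $n\ge 1$, binary terms $\alpha_1(x,y),\dots,\alpha_n(x,y)$ and an $(n+1)$-ary term $\beta$ satisfying the identities $\alpha_i(x,x)=0$ for $i\in\{1,\dots,n\}$ and $\beta(\alpha_1(x,y),\dots,\alpha_n(x,y),y)=x$. An object $Z$ of $\mathcal C$ is $A$-null if the only morphism $A\to Z$ is the zero morphism. The $A$-nullification functor $P_A\colon\mathcal C\to\mathcal C$, with coaugmentation $\eta\colon 1_{\mathcal C}\Rightarrow P_A$, is the localization functor associated to the full replete subcategory $\mathcal X$ of $A$-null objects (which is reflective in $\mathcal C$): $P_A=UF$ with $U\colon\mathcal X\to\mathcal C$ the inclusion, $F$ its left adjoint, and $\eta$ the unit. Write $L=P_A$. An extension in $\mathcal C$ is a short exact sequence $0\to K\to E\to Q\to 0$ (the first map is a kernel of the second, the second is a cokernel of the first). An extension $0\to K\to E\to Q\to 0$ admits a fiberwise localization (with respect to $L$) if there is an extension $0\to L(K)\to\overline E\to Q\to 0$ and a morphism $e\colon E\to\overline E$ with $L(e)$ an isomorphism such that $(\eta_K,e,1_Q)$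 is a morphism of extensions. $L$ admits a functorial fiberwise localization if every extension is assigned a fiberwise localization in a functorial way: every morphism of extensions $(u,v,w)$ from $0\to K\to E\to Q\to 0$ to $0\to K'\to E'\to Q'\to 0$ is assigned a morphism $\overline v\colon\overline E\to\overline{E'}$ such that $(L(u),\overline v,w)$ is a morphism between the fiberwise localized extensions and $\overline v\circ e=e'\circ v$, and this assignment preserves identities and composition. $L=UF$ is semi-left-exact if, for every object $X$ of $\mathcal C$ and every morphism $x\colon E\to F(X)$ in $\mathcal X$, the reflector $F$ preserves the pullback $X\times_{UF(X)}U(E)$ of $\eta_X\colon X\to UF(X)$ and $U(x)\colon U(E)\to UF(X)$. An extension is $L$-flat if $0\to L(K)\to L(E)\to L(Q)\to 0$ is again an extension. $L$ is conditionally flat if every pullback of an $L$-flat extension is $L$-flat: for every $L$-flat extension $0\to K\to E\to Q\to 0$ and every morphism $X\to Q$, the induced extension $0\to K\to E\times_Q X\to X\to 0$ is $L$-flat. *)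

(* Defs.v *)
From mathcomp Require Import all_boot.
From mathcomp Require Import boolp.

Set Implicit Arguments.
Unset Strict Implicit.
Unset Printing Implicit Defensive.

Declare Scope cat_scope.
Delimit Scope cat_scope with cat.
Local Open Scope cat_scope.

(** * Categories and functors *)

Record category := Category {
  obj :> Type;
  hom : obj -> obj -> Type;
  idm : forall X, hom X X;
  comp : forall X Y Z, hom Y Z -> hom X Y -> hom X Z;
  comp1m : forall X Y (f : hom X Y), comp (idm Y) f = f;
  compm1 : forall X Y (f : hom X Y), comp f (idm X) = f;
  compA : forall X Y Z W (h : hom Z W) (g : hom Y Z) (f : hom X Y),
    comp h (comp g f) = comp (comp h g) f }.

Arguments hom {c} X Y.
Arguments idm {c} X.
Arguments comp {c X Y Z} g f.
Notation "g ∘ f" := (comp g f)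
  (at level 40, left associativity) : cat_scope.

Record functor (C D : category) := Functor {
  fobj :> C -> D;
  fmap : forall X Y : C, hom X Y -> hom (fobj X) (fobj Y);
  fmap1 : forall X, fmap (idm X) = idm (fobj X);
  fmapM : forall X Y Z (g : hom Y Z) (f : hom X Y),
    fmap (g ∘ f) = fmap g ∘ fmap f }.

Arguments fmap {C D} F {X Y} f : rename.

Section FunctorComp.
Variables (C D E : category) (G : functor D E) (F : functor C D).

Lemma functor_comp1 X : fmap G (fmap F (idm X)) = idm (G (F X)).
Proof. by rewrite !fmap1. Qed.

Lemma functor_compM X Y Z (g : hom Y Z) (f : hom X Y) :
  fmap G (fmap F (g ∘ f)) = fmap G (fmap F g) ∘ fmap G (fmap F f).
Proof. by rewrite !fmapM. Qed.

Definition functor_comp : functor C E :=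
  @Functor C E (fun X => G (F X)) (fun X Y f => fmap G (fmap F f))
    functor_comp1 functor_compM.
End FunctorComp.

Section FullSubcategory.
Variables (C : category) (P : C -> Prop).

Definition full_sub : category :=
  @Category {X : C | P X}
    (fun X Y => hom (proj1_sig X) (proj1_sig Y))
    (fun X => idm (proj1_sig X))
    (fun X Y Z g f => g ∘ f)
    (fun X Y f => comp1m f)
    (fun X Y f => compm1 f)
    (fun X Y Z W h g f => compA h g f).

Definition full_incl : functor full_sub C :=
  @Functor full_sub C (@proj1_sig C P) (fun X Y f => f)
    (fun X => erefl) (fun X Y Z g f => erefl).
End FullSubcategory.

(** * Universal constructions *)

Section Universal.
Variable C : category.
Implicit Types X Y Z T : C.

Definition is_iso X Y (f : hom X Y) : Prop :=
  exists g : hom Y X, g ∘ f = idm X /\ f ∘ g = idm Y.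

Definition is_initial X : Prop := forall Y, exists! f : hom X Y, True.
Definition is_terminal X : Prop := forall Y, exists! f : hom Y X, True.
Definition is_zero_obj X : Prop := is_initial X /\ is_terminal X.

Definition is_zero X Y (f : hom X Y) : Prop :=
  exists (Z : C) (g : hom Z Y) (h : hom X Z), is_zero_obj Z /\ f = g ∘ h.

(* The square with legs a : W -> X, b : W -> Y over f : X -> Z, g : Y -> Z. *)
Definition is_pullback W X Y Z (a : hom W X) (b : hom W Y)
    (f : hom X Z) (g : hom Y Z) : Prop :=
  f ∘ a = g ∘ b /\
  forall T (x : hom T X) (y : hom T Y), f ∘ x = g ∘ y ->
    exists! u : hom T W, a ∘ u = x /\ b ∘ u = y.

Definition is_coproduct X Y S (i : hom X S) (j : hom Y S) : Prop :=
  forall T (x : hom X T) (y : hom Y T),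
    exists! u : hom S T, u ∘ i = x /\ u ∘ j = y.

Definition is_coequalizer X Y Q (q : hom Y Q) (f g : hom X Y) : Prop :=
  q ∘ f = q ∘ g /\
  forall T (t : hom Y T), t ∘ f = t ∘ g -> exists! u : hom Q T, u ∘ q = t.

Definition is_regular_epi Y Q (q : hom Y Q) : Prop :=
  exists (X : C) (f g : hom X Y), is_coequalizer q f g.

Definition is_kernel K X Y (k : hom K X) (f : hom X Y) : Prop :=
  is_zero (f ∘ k) /\
  forall T (t : hom T X), is_zero (f ∘ t) -> exists! u : hom T K, k ∘ u = t.

Definition is_cokernel X Y Q (q : hom Y Q) (f : hom X Y) : Prop :=
  is_zero (q ∘ f) /\
  forall T (t : hom Y T), is_zero (t ∘ f) -> exists! u : hom Q T, u ∘ q = t.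

Definition is_short_exact K E Q (i : hom K E) (p : hom E Q) : Prop :=
  is_kernel i p /\ is_cokernel p i.

(* (d1, d2) is an internal equivalence relation on X: it is jointly monic and
   induces an equivalence relation on every hom-set hom T X. *)
Definition is_equiv_rel R X (d1 d2 : hom R X) : Prop :=
  let rel T (x y : hom T X) := exists u : hom T R, d1 ∘ u = x /\ d2 ∘ u = y in
  [/\ forall T (u v : hom T R), d1 ∘ u = d1 ∘ v -> d2 ∘ u = d2 ∘ v -> u = v,
      forall T (x : hom T X), rel T x x,
      forall T (x y : hom T X), rel T x y -> rel T y x
    & forall T (x y z : hom T X), rel T x y -> rel T y z -> rel T x z].
End Universal.

(** * Semi-abelian categories *)

Section SemiAbelian.
Variable C : category.

Definition pointed : Prop := exists Z : C, is_zero_obj Z.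

Definition has_pullbacks : Prop :=
  forall (X Y Z : C) (f : hom X Z) (g : hom Y Z),
    exists (W : C) (a : hom W X) (b : hom W Y), is_pullback a b f g.

Definition finitely_complete : Prop :=
  (exists T : C, is_terminal T) /\ has_pullbacks.

Definition has_finite_coproducts : Prop :=
  (exists I : C, is_initial I) /\
  forall X Y : C,
    exists (S : C) (i : hom X S) (j : hom Y S), is_coproduct i j.

Definition regular_category : Prop :=
  [/\ finitely_complete,
      forall (R X Y : C) (a b : hom R X) (f : hom X Y), is_pullback a b f f ->
        exists (Q : C) (q : hom X Q), is_coequalizer q a b
    & forall (W X Y Z : C) (a : hom W X) (b : hom W Y)
             (f : hom X Z) (g : hom Y Z),
        is_pullback a b f g -> is_regular_epi f -> is_regular_epi b].

Definition barr_exact : Prop :=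
  regular_category /\
  forall (R X : C) (d1 d2 : hom R X), is_equiv_rel d1 d2 ->
    exists (Y : C) (f : hom X Y), is_pullback d1 d2 f f.

(* Bourn protomodularity: for every g : X -> B, the change-of-base functor
   along g, from points (split epimorphisms with a chosen section) over B to
   points over X, reflects isomorphisms; k is the image of h under it. *)
Definition protomodular : Prop :=
  forall (B E E' : C) (p : hom E B) (s : hom B E)
         (p' : hom E' B) (s' : hom B E') (h : hom E E'),
    p ∘ s = idm B -> p' ∘ s' = idm B -> p' ∘ h = p -> h ∘ s = s' ->
  forall (X : C) (g : hom X B)
         (W : C) (a : hom W E) (b : hom W X)
         (W' : C) (a' : hom W' E') (b' : hom W' X) (k : hom W W'),
    is_pullback a b p g -> is_pullback a' b' p' g ->
    a' ∘ k = h ∘ a -> b' ∘ k = b ->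
    is_iso k -> is_iso h.

Definition semi_abelian : Prop :=
  [/\ pointed, has_finite_coproducts, barr_exact & protomodular].
End SemiAbelian.

(** * Reflections and nullification *)

(* The left adjoint refl of the inclusion U of the full subcategory of the
   objects satisfying P, given by its unit eta. *)
Record reflection (C : category) (P : C -> Prop) := Reflection {
  refl : functor C (full_sub P);
  eta : forall X : C, hom X (full_incl P (refl X));
  eta_natural : forall (X Y : C) (f : hom X Y),
    fmap (full_incl P) (fmap refl f) ∘ eta X = eta Y ∘ f;
  eta_universal : forall (X : C) (Z : full_sub P) (f : hom X (full_incl P Z)),
    exists! g : hom (refl X) Z, fmap (full_incl P) g ∘ eta X = f }.

Arguments refl {C P} R : rename.
Arguments eta {C P} R X : rename.

Definition localization (C : category) (P : C -> Prop) (R : reflection P) :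
  functor C C := functor_comp (full_incl P) (refl R).

Definition is_null (C : category) (A Z : C) : Prop :=
  forall f : hom A Z, is_zero f.

Definition nullification (C : category) (A : C) := reflection (is_null A).

(** * Extensions and fiberwise localization *)

Record extension (C : category) (K E Q : C) := Extension {
  ext_i : hom K E;
  ext_p : hom E Q;
  ext_exact : is_short_exact ext_i ext_p }.

Definition is_ext_mor (C : category) (K E Q K' E' Q' : C)
    (x : extension K E Q) (x' : extension K' E' Q')
    (u : hom K K') (v : hom E E') (w : hom Q Q') : Prop :=
  v ∘ ext_i x = ext_i x' ∘ u /\ w ∘ ext_p x = ext_p x' ∘ v.

Record ext_mor (C : category) (K E Q K' E' Q' : C)
    (x : extension K E Q) (x' : extension K' E' Q') := ExtMor {
  mor_u : hom K K';
  mor_v : hom E E';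
  mor_w : hom Q Q';
  mor_comm : is_ext_mor x x' mor_u mor_v mor_w }.

Section ExtMor.
Variable C : category.

Lemma ext_id_comm (K E Q : C) (x : extension K E Q) :
  is_ext_mor x x (idm K) (idm E) (idm Q).
Proof. by split; rewrite comp1m compm1. Qed.

Definition ext_id (K E Q : C) (x : extension K E Q) : ext_mor x x :=
  ExtMor (ext_id_comm x).

Lemma ext_comp_comm (K E Q K' E' Q' K2 E2 Q2 : C)
    (x : extension K E Q) (x' : extension K' E' Q') (x2 : extension K2 E2 Q2)
    (n : ext_mor x' x2) (m : ext_mor x x') :
  is_ext_mor x x2 (mor_u n ∘ mor_u m) (mor_v n ∘ mor_v m) (mor_w n ∘ mor_w m).
Proof.
case: n m => [u' v' w' [n1 n2]] [u v w [m1 m2]]; split => /=.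
  by rewrite -compA m1 compA n1 compA.
by rewrite -compA m2 compA n2 compA.
Qed.

Definition ext_comp (K E Q K' E' Q' K2 E2 Q2 : C)
    (x : extension K E Q) (x' : extension K' E' Q') (x2 : extension K2 E2 Q2)
    (n : ext_mor x' x2) (m : ext_mor x x') : ext_mor x x2 :=
  ExtMor (ext_comp_comm n m).
End ExtMor.

Section Localization.
Variables (C : category) (P : C -> Prop) (R : reflection P).
Let L := localization R.

Record fiberwise_localization (K E Q : C) (x : extension K E Q) :=
    FiberwiseLocalization {
  fl_obj : C;
  fl_ext : extension (L K) fl_obj Q;
  fl_e : hom E fl_obj;
  fl_e_iso : is_iso (fmap L fl_e);
  fl_e_mor : is_ext_mor x fl_ext (eta R K) fl_e (idm Q) }.

Record functorial_fiberwise_localization := FunctorialFiberwiseLocalization {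
  ffl : forall (K E Q : C) (x : extension K E Q), fiberwise_localization x;
  ffl_map : forall (K E Q K' E' Q' : C)
    (x : extension K E Q) (x' : extension K' E' Q'),
    ext_mor x x' -> hom (fl_obj (ffl x)) (fl_obj (ffl x'));
  ffl_map_mor : forall (K E Q K' E' Q' : C)
    (x : extension K E Q) (x' : extension K' E' Q') (m : ext_mor x x'),
    is_ext_mor (fl_ext (ffl x)) (fl_ext (ffl x'))
      (fmap L (mor_u m)) (ffl_map m) (mor_w m);
  ffl_map_e : forall (K E Q K' E' Q' : C)
    (x : extension K E Q) (x' : extension K' E' Q') (m : ext_mor x x'),
    ffl_map m ∘ fl_e (ffl x) = fl_e (ffl x') ∘ mor_v m;
  ffl_map1 : forall (K E Q : C) (x : extension K E Q),
    ffl_map (ext_id x) = idm (fl_obj (ffl x));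
  ffl_mapM : forall (K E Q K' E' Q' K2 E2 Q2 : C)
    (x : extension K E Q) (x' : extension K' E' Q') (x2 : extension K2 E2 Q2)
    (n : ext_mor x' x2) (m : ext_mor x x'),
    ffl_map (ext_comp n m) = ffl_map n ∘ ffl_map m }.

Definition admits_functorial_fiberwise_localization : Prop :=
  inhabited functorial_fiberwise_localization.

Definition semi_left_exact : Prop :=
  forall (X : C) (E : full_sub P) (x : hom E (refl R X))
         (W : C) (a : hom W X) (b : hom W (full_incl P E)),
    is_pullback a b (eta R X) (fmap (full_incl P) x) ->
    is_pullback (fmap (refl R) a) (fmap (refl R) b)
      (fmap (refl R) (eta R X)) (fmap (refl R) (fmap (full_incl P) x)).

Definition flat_extension (K E Q : C) (i : hom K E) (p : hom E Q) : Prop :=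
  is_short_exact i p /\ is_short_exact (fmap L i) (fmap L p).

(* i' : K -> W is the morphism induced by i and 0 into the pullback W. *)
Definition conditionally_flat : Prop :=
  forall (K E Q : C) (i : hom K E) (p : hom E Q), flat_extension i p ->
  forall (X : C) (g : hom X Q) (W : C) (a : hom W E) (b : hom W X)
         (i' : hom K W),
    is_pullback a b p g -> a ∘ i' = i -> is_zero (b ∘ i') ->
    flat_extension i' b.
End Localization.

(** * Varieties of universal algebras *)

Record signature := Signature {
  op : Type;
  arity : op -> nat }.

Inductive term (S : signature) (V : Type) :=
| Var of V
| App (f : op S) of ('I_(arity f) -> term S V).

(* A set of pairs of terms in countably many variables. *)
Definition identities (S : signature) := term S nat -> term S nat -> Prop.

Section Varieties.
Variables (S : signature) (Th : identities S).

Section Eval.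
Variables (V X : Type) (o : forall f : op S, ('I_(arity f) -> X) -> X).

Fixpoint eval (env : V -> X) (t : term S V) : X :=
  match t with
  | Var v => env v
  | App f ts => o (fun j => eval env (ts j))
  end.
End Eval.

Record algebra := Algebra {
  carrier :> Type;
  oper : forall f : op S, ('I_(arity f) -> carrier) -> carrier;
  alg_identities : forall s t : term S nat, Th s t ->
    forall env : nat -> carrier, eval oper env s = eval oper env t }.

Arguments oper a {f} xs : rename.

Record alg_hom (X Y : algebra) := AlgHom {
  alg_fun :> X -> Y;
  alg_funE : forall (f : op S) (xs : 'I_(arity f) -> X),
    alg_fun (oper X xs) = oper Y (fun j => alg_fun (xs j)) }.

Lemma alg_hom_eq (X Y : algebra) (g h : alg_hom X Y) : g =1 h -> g = h.
Proof.
case: g h => [g gE] [h hE] /= /funext gh; case: h / gh hE => hE.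
by rewrite (Prop_irrelevance gE hE).
Qed.

Definition alg_id (X : algebra) : alg_hom X X :=
  @AlgHom X X id (fun f xs => erefl).

Lemma alg_compE (X Y Z : algebra) (h : alg_hom Y Z) (g : alg_hom X Y)
    (f : op S) (xs : 'I_(arity f) -> X) :
  h (g (oper X xs)) = oper Z (fun j => h (g (xs j))).
Proof. by rewrite !alg_funE. Qed.

Definition alg_comp (X Y Z : algebra) (h : alg_hom Y Z) (g : alg_hom X Y) :
  alg_hom X Z := @AlgHom X Z (fun x => h (g x)) (@alg_compE X Y Z h g).

Definition variety : category :=
  @Category algebra alg_hom alg_id alg_comp
    (fun X Y f => @alg_hom_eq _ _ (alg_comp (alg_id Y) f) f (fun x => erefl))
    (fun X Y f => @alg_hom_eq _ _ (alg_comp f (alg_id X)) f (fun x => erefl))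
    (fun X Y Z W h g f =>
       @alg_hom_eq _ _ (alg_comp h (alg_comp g f)) (alg_comp (alg_comp h g) f)
         (fun x => erefl)).
End Varieties.

(* Main.v *)
(** Null objects are closed under subobjects and
    extensions, so each eta_X : X -> L X is a regular epimorphism, with kernel
    T say. Fiberwise localization of T -> X -> L X gives an extension of L X by
    L T whose total object is null and L-equivalent to X; it is therefore L X,
    and L T = 0. Hence eta_X and all its pullbacks are regular epimorphisms with
    an L-acyclic kernel. As regular epimorphisms are cokernels of their kernels,
    these pullbacks are L-equivalences, which is semi-left-exactness.
    For an L-flat extension p : E -> Q, the same argument shows that L preserves
    the pullback of p along any X -> Q, and extensions are pullback stable. *)

From mathcomp Require Import ssreflect ssrfun ssrbool.
Require Import Defs.

Set Implicit Arguments.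
Unset Strict Implicit.
Unset Printing Implicit Defensive.

Local Open Scope cat_scope.

(** * Zero morphisms, pullbacks and kernels *)

Section Category.
Variable C : category.
Implicit Types X Y Z T : C.

Definition is_mono X Y (m : hom X Y) : Prop :=
  forall T (u v : hom T X), m ∘ u = m ∘ v -> u = v.

Definition is_epi X Y (q : hom X Y) : Prop :=
  forall T (u v : hom Y T), u ∘ q = v ∘ q -> u = v.

(** Agrees with regular epimorphisms in a regular category, and passes to the last factor of a
    composite directly from the definition. *)
Definition is_extremal_epi X Y (q : hom X Y) : Prop :=
  forall I (m : hom I Y) (g : hom X I), is_mono m -> q = m ∘ g -> is_iso m.

Lemma exists_uniq (U : Type) (P : U -> Prop) u v : (exists! x, P x) -> P u -> P v -> u = v.
Proof. by move=> [w [_ wU]] /wU <- /wU. Qed.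

Lemma zero_uniq X Y (f g : hom X Y) : is_zero f -> is_zero g -> f = g.
Proof.
move=> [Z1 [g1 [h1 [[i1 _] ->]]]] [Z2 [g2 [h2 [[_ t2] ->]]]].
(* The two maps may factor through different zero objects, which [j] compares. *)
have [j _] := i1 Z2.
rewrite (exists_uniq (i1 Y) (u := g1) (v := g2 ∘ j)) //.
by rewrite -compA (exists_uniq (t2 X) (u := j ∘ h1) (v := h2)).
Qed.

Lemma zero_compl X Y Z (g : hom Y Z) (f : hom X Y) : is_zero f -> is_zero (g ∘ f).
Proof.
by move=> [O [u [v [O0 ->]]]]; exists O, (g ∘ u), v; rewrite compA.
Qed.

Lemma zero_compr X Y Z (g : hom Y Z) (f : hom X Y) : is_zero g -> is_zero (g ∘ f).
Proof.
by move=> [O [u [v [O0 ->]]]]; exists O, u, (v ∘ f); rewrite compA.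
Qed.

Lemma zero_exists X Y : pointed C -> exists f : hom X Y, is_zero f.
Proof.
move=> [O [Oi Ot]]; have [u _] := Oi Y; have [v _] := Ot X.
by exists (u ∘ v), O, u, v.
Qed.

Lemma mono_zero X Y Z (m : hom Y Z) (f : hom X Y) :
  pointed C -> is_mono m -> is_zero (m ∘ f) -> is_zero f.
Proof.
move=> pC mm mf; have [z z0] := zero_exists X Y pC.
by rewrite (mm _ f z) //; apply: zero_uniq => //; apply: zero_compl.
Qed.

Lemma iso_mono X Y (f : hom X Y) : is_iso f -> is_mono f.
Proof.
by move=> [g [gf _]] T u v e; rewrite -(comp1m u) -(comp1m v) -gf -!compA e.
Qed.

Lemma mono_retraction_iso X Y (m : hom X Y) (r : hom Y X) :
  is_mono m -> m ∘ r = idm Y -> is_iso m.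
Proof.
by move=> mm mr; exists r; split=> //; apply: mm; rewrite compA mr comp1m compm1.
Qed.

Section Pullback.
Variables (W X Y Z : C) (a : hom W X) (b : hom W Y) (f : hom X Z) (g : hom Y Z).

Lemma pullback_sym : is_pullback a b f g -> is_pullback b a g f.
Proof.
move=> [e U]; split=> // T y x /esym /U [u [[ua ub] uU]].
by exists u; split=> // v [vb va]; apply: uU.
Qed.

Hypothesis pb : is_pullback a b f g.

Lemma pullback_lift T (x : hom T X) (y : hom T Y) :
  f ∘ x = g ∘ y -> exists u : hom T W, a ∘ u = x /\ b ∘ u = y.
Proof. by move=> /(pb.2) [u [? _]]; exists u. Qed.

Lemma pullback_uniq T (u v : hom T W) : a ∘ u = a ∘ v -> b ∘ u = b ∘ v -> u = v.
Proof.
move=> eu ev; have e : f ∘ (a ∘ v) = g ∘ (b ∘ v) by rewrite !compA pb.1.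
exact: exists_uniq (pb.2 _ _ _ e) (conj eu ev) (conj erefl erefl).
Qed.

Lemma pullback_mono : is_mono f -> is_mono b.
Proof.
move=> fm T u v e; apply: pullback_uniq => //.
by apply: fm; rewrite !compA pb.1 -!compA e.
Qed.

Lemma pullback_kernel_lift K (i : hom K X) : pointed C -> is_kernel i f ->
  exists i' : hom K W, a ∘ i' = i /\ is_zero (b ∘ i').
Proof.
move=> pC [i0 _]; have [z z0] := zero_exists K Y pC.
have [|i' [ai bi]] := @pullback_lift _ i z.
  by apply: zero_uniq => //; apply: zero_compl.
by exists i'; rewrite bi.
Qed.

Lemma pullback_kernel K (i : hom K X) (i' : hom K W) :
  is_kernel i f -> a ∘ i' = i -> is_zero (b ∘ i') -> is_kernel i' b.
Proof.
move=> [_ iU] ai bi; split=> // T t bt.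
have [|u [iu uU]] := iU _ (a ∘ t).
  by rewrite compA pb.1 -compA; apply: zero_compl.
exists u; split.
  apply: pullback_uniq; first by rewrite compA ai.
  by apply: zero_uniq => //; rewrite compA; apply: zero_compr.
by move=> v iv; apply: uU; rewrite -ai -iv compA.
Qed.

End Pullback.

Lemma iso_pullback W X Y Z (a : hom W X) (b : hom W Y) (f : hom X Z) (g : hom Y Z) :
  f ∘ a = g ∘ b -> is_iso b -> is_iso f -> is_pullback a b f g.
Proof.
move=> e bI fI; have [b' [b'b bb']] := bI; split=> // T x y exy.
exists (b' ∘ y); split; last first.
  by move=> v [_ <-]; rewrite compA b'b comp1m.
split; last by rewrite compA bb' comp1m.
by apply: (iso_mono fI); rewrite exy compA e -compA (compA b) bb' comp1m.
Qed.

Lemma pullback_iso V W X Y Z (a : hom W X) (b : hom W Y) (f : hom X Z)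
    (g : hom Y Z) (h : hom V W) :
  is_pullback a b f g -> is_iso h -> is_pullback (a ∘ h) (b ∘ h) f g.
Proof.
move=> pb [h' [h'h hh']]; split; first by rewrite !compA pb.1.
move=> T x y /(pullback_lift pb) [u [<- <-]]; exists (h' ∘ u); split.
  by rewrite -!compA (compA h) hh' comp1m.
move=> v [av bv]; rewrite (_ : u = h ∘ v) ?compA ?h'h ?comp1m //.
by apply: (pullback_uniq pb); rewrite compA.
Qed.

Lemma kernel_mono K X Y (k : hom K X) (f : hom X Y) : is_kernel k f -> is_mono k.
Proof.
move=> [k0 kU] T u v e; apply: (exists_uniq (kU _ (k ∘ v) _)) => //.
by rewrite compA; apply: zero_compr.
Qed.

Lemma kernel_exists X Y (f : hom X Y) : pointed C -> has_pullbacks C ->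
  exists (K : C) (k : hom K X), is_kernel k f.
Proof.
move=> [O O0] hP; have [z _] := O0.1 Y.
have [K [k [b pb]]] := hP _ _ _ f z; exists K, k; split.
  by exists O, z, b; split=> //; exact: pb.1.
move=> T t ft; have [o _] := O0.2 T.
have e : f ∘ t = z ∘ o by apply: zero_uniq => //; exists O, z, o.
have [u [ku bu]] := pullback_lift pb e; exists u; split=> // v kv.
apply: (pullback_uniq pb); first by rewrite kv.
exact: (exists_uniq (O0.2 T)).
Qed.

(** Brings a kernel into the form of a change of base, to which protomodularity applies. *)
Lemma kernel_pullback K X Y O (k : hom K X) (f : hom X Y) (b : hom K O) (z : hom O Y) :
  is_zero_obj O -> is_kernel k f -> is_pullback k b f z.
Proof.
move=> O0 [k0 kU]; split.
  by apply: zero_uniq => //; exists O, z, b.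
move=> T x y e; have [|u [ku uU]] := kU _ x; first by rewrite e; exists O, z, y.
exists u; split; last by move=> v [/uU].
by split=> //; apply: (exists_uniq (O0.2 T)).
Qed.

(** The equalizer is the pullback of the diagonal of [Y × Y] along the pair of [f] and [g]; the
    product is a pullback over the terminal object. *)
Lemma equalizer_exists X Y (f g : hom X Y) : finitely_complete C ->
  exists (E : C) (e : hom E X), [/\ is_mono e, f ∘ e = g ∘ e &
    forall T (t : hom T X), f ∘ t = g ∘ t -> exists u : hom T E, e ∘ u = t].
Proof.
move=> [[O Ot] hP]; have [o _] := Ot Y.
have [D [p [q pD]]] := hP _ _ _ o o.
have [d [pd qd]] : exists d : hom Y D, p ∘ d = idm Y /\ q ∘ d = idm Y.
  exact: (pullback_lift pD).
have [|h [ph qh]] := pullback_lift pD (x := f) (y := g).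
  exact: (exists_uniq (Ot X)).
have [E [b [e pE]]] := hP _ _ _ d h.
have fe : f ∘ e = b by rewrite -ph -compA -pE.1 compA pd comp1m.
have ge : g ∘ e = b by rewrite -qh -compA -pE.1 compA qd comp1m.
exists E, e; split; rewrite ?fe ?ge //.
  apply: (pullback_mono pE) => T u v duv.
  by rewrite -(comp1m u) -(comp1m v) -pd -!compA duv.
move=> T t ft; have [|u [_ eu]] := pullback_lift pE (x := f ∘ t) (y := t).
  by apply: (pullback_uniq pD); rewrite !compA ?pd ?qd ?ph ?qh comp1m.
by exists u.
Qed.

(** * Regular epimorphisms *)

Lemma regular_epi_epi X Y (q : hom X Y) : is_regular_epi q -> is_epi q.
Proof.
move=> [R [f [g [e U]]]] T u v euv.
have E : (v ∘ q) ∘ f = (v ∘ q) ∘ g by rewrite -!compA e.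
exact: exists_uniq (U _ _ E) euv erefl.
Qed.

(** Since [m] is monic, [x] coequalizes any pair that [q] coequalizes, hence factors through [q]. *)
Lemma regular_epi_lift X Y I T (q : hom X Y) (m : hom I T) (x : hom X I) (y : hom Y T) :
  is_regular_epi q -> is_mono m -> m ∘ x = y ∘ q -> exists u : hom Y I, m ∘ u = y.
Proof.
move=> qR mm e; have qE := regular_epi_epi qR.
have [R [f [g [qf U]]]] := qR.
have [|u [uq _]] := U _ x; first by apply: mm; rewrite !compA e -!compA qf.
by exists u; apply: qE; rewrite -compA uq.
Qed.

Lemma regular_epi_extremal X Y (q : hom X Y) : is_regular_epi q -> is_extremal_epi q.
Proof.
move=> qR I m g mm e.
have [|u mu] := regular_epi_lift qR mm (x := g) (y := idm Y).
  by rewrite comp1m.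
exact: mono_retraction_iso mu.
Qed.

Lemma extremal_epi_compr X Y Z (f : hom X Y) (g : hom Y Z) :
  is_extremal_epi (g ∘ f) -> is_extremal_epi g.
Proof. by move=> gf I m h mm e; apply: (gf _ m (h ∘ f)) => //; rewrite e compA. Qed.

Lemma regular_epi_iso X Y Z (q : hom X Y) (f : hom Y Z) :
  is_regular_epi q -> is_iso f -> is_regular_epi (f ∘ q).
Proof.
move=> qR [g [gf fg]]; have qE := regular_epi_epi qR.
have [R [x [y [e U]]]] := qR; exists R, x, y; split; first by rewrite -!compA e.
move=> T t /U [u [uq _]]; exists (u ∘ g); split.
  by rewrite -compA (compA g) gf comp1m.
move=> v vq; rewrite -(compm1 v) -fg compA; congr (_ ∘ g).
by apply: qE; rewrite uq -compA vq.
Qed.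

Lemma cokernel_regular_epi X Y Q (f : hom X Y) (q : hom Y Q) :
  pointed C -> is_cokernel q f -> is_regular_epi q.
Proof.
move=> pC [q0 U]; have [z z0] := zero_exists X Y pC; exists X, f, z; split.
  by apply: zero_uniq => //; apply: zero_compl.
by move=> T t e; apply: U; rewrite e; apply: zero_compl.
Qed.

Hypothesis regC : regular_category C.

Let hP : has_pullbacks C.
Proof. by case: regC => -[]. Qed.

Lemma regular_epi_pullback W X Y Z (a : hom W X) (b : hom W Y) (f : hom X Z) (g : hom Y Z) :
  is_pullback a b f g -> is_regular_epi f -> is_regular_epi b.
Proof. by case: regC => _ _; apply. Qed.

(** The image is the coequalizer of the kernel pair [R]; two maps that [m] identifies lift, on a
    regular cover, to a pair in [R], which [q] identifies already. *)
Lemma regular_epi_mono_factor X Y (f : hom X Y) :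
  exists (I : C) (q : hom X I) (m : hom I Y),
    [/\ is_regular_epi q, is_mono m & f = m ∘ q].
Proof.
have [R [d1 [d2 pR]]] := hP f f.
have [_ /(_ _ _ _ _ _ _ pR) [I [q qC]] _] := regC.
have qR : is_regular_epi q by exists R, d1, d2.
have [m [mq _]] := qC.2 _ _ pR.1; exists I, q, m; split=> // T u v e.
(* Cover T so that both u and v lift along q. *)
have [T1 [x [e1 p1]]] := hP q u.
have [T2 [y [e2 p2]]] := hP q (v ∘ e1).
apply: (regular_epi_epi (regular_epi_pullback p1 qR)).
apply: (regular_epi_epi (regular_epi_pullback p2 qR)).
rewrite -p2.1 -p1.1 -compA.
have [|w [<- <-]] := pullback_lift pR (x := x ∘ e2) (y := y).
  by rewrite -mq -!compA p2.1 (compA q) p1.1 !compA e.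
by rewrite !compA qC.1.
Qed.

Lemma extremal_epi_regular X Y (f : hom X Y) : is_extremal_epi f -> is_regular_epi f.
Proof.
move=> fE; have [I [q [m [qR mm e]]]] := regular_epi_mono_factor f.
by rewrite e; apply: regular_epi_iso => //; exact: fE e.
Qed.

Lemma regular_epi_compr X Y Z (f : hom X Y) (g : hom Y Z) :
  is_regular_epi (g ∘ f) -> is_regular_epi g.
Proof.
by move=> /regular_epi_extremal /extremal_epi_compr /extremal_epi_regular.
Qed.

(** * Protomodularity *)

Hypotheses (pC : pointed C) (protC : protomodular C).

(** Over [B], [m] is a morphism of points, and base change to the zero object turns it into the
    identity of [K], so protomodularity makes [m] invertible. *)
Lemma split_epi_kernel_section_iso B E K M (p : hom E B) (s : hom B E) (k : hom K E)
    (m : hom M E) (s' : hom B M) (k' : hom K M) :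
  p ∘ s = idm B -> is_kernel k p -> is_mono m -> m ∘ s' = s -> m ∘ k' = k -> is_iso m.
Proof.
move=> ps kK mm ms mk; have [O O0] := pC.
have [b _] := O0.2 K; have [z _] := O0.1 B.
have kK' : is_kernel k' (p ∘ m).
  split=> [|T t]; first by rewrite -compA mk; exact: kK.1.
  rewrite -compA => /(kK.2) [u [ku uU]]; exists u; split.
    by apply: mm; rewrite compA mk.
  by move=> v kv; apply: uU; rewrite -mk -compA kv.
apply: (@protC B M E (p ∘ m) s' p s m _ _ _ _ O z K k' b K k b (idm K)) => //.
- by rewrite -compA ms.
- exact: kernel_pullback.
- exact: kernel_pullback.
- by rewrite compm1.
- by rewrite compm1.
- by exists (idm K); rewrite comp1m.
Qed.

(** If [t] kills [k], the equalizer of [t ∘ d1] and [t ∘ d2] contains the diagonal and the kernel of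
    [d1], so it is the whole kernel pair; [t] then factors through [q]. *)
Lemma regular_epi_cokernel X Y K (q : hom X Y) (k : hom K X) :
  is_regular_epi q -> is_kernel k q -> is_cokernel q k.
Proof.
move=> qR kK; have qE := regular_epi_epi qR; split; first exact: kK.1.
move=> T t tk; have [R [d1 [d2 pR]]] := hP q q.
have [|s [d1s d2s]] := pullback_lift pR (x := idm X) (y := idm X) => //.
have [k' [d2k d1k]] := pullback_kernel_lift (pullback_sym pR) pC kK.
have kK' := pullback_kernel (pullback_sym pR) kK d2k d1k.
have [fC _ _] := regC.
have [E [e [em te eU]]] := equalizer_exists (t ∘ d1) (t ∘ d2) fC.
have [|s' es] := eU _ s; first by rewrite -!compA d1s d2s.
have [|k2 ek] := eU _ k'.
  by rewrite -!compA; apply: zero_uniq; [apply: zero_compl | rewrite d2k].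
have [e' [_ ee']] := split_epi_kernel_section_iso d1s kK' em es ek.
have td : t ∘ d1 = t ∘ d2.
  by rewrite -(compm1 (t ∘ d1)) -(compm1 (t ∘ d2)) -ee' !compA te.
have [S [f [g [qfg U]]]] := qR.
have [w [d1w d2w]] := pullback_lift pR qfg.
by apply: U; rewrite -d1w -d2w !compA td.
Qed.

Lemma regular_epi_short_exact X Y K (q : hom X Y) (k : hom K X) :
  is_regular_epi q -> is_kernel k q -> is_short_exact k q.
Proof. by split=> //; apply: regular_epi_cokernel. Qed.

Lemma pullback_short_exact K W X Y Z (a : hom W X) (b : hom W Y) (f : hom X Z)
    (g : hom Y Z) (i : hom K X) (i' : hom K W) :
  is_pullback a b f g -> is_short_exact i f -> a ∘ i' = i -> is_zero (b ∘ i') ->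
  is_short_exact i' b.
Proof.
move=> pb [iK fC] ai bi; apply: regular_epi_short_exact.
  exact: regular_epi_pullback pb (cokernel_regular_epi pC fC).
exact: (pullback_kernel pb iK ai bi).
Qed.

(* Pulling back along the regular epimorphism p ∘ m turns p into a split
   epimorphism, to which [split_epi_kernel_section_iso] applies. *)
Lemma mono_kernel_iso B E K M (p : hom E B) (k : hom K E) (m : hom M E) (k' : hom K M) :
  is_kernel k p -> is_mono m -> is_regular_epi (p ∘ m) -> m ∘ k' = k -> is_iso m.
Proof.
move=> kK mm pmR mk.
have [D [x [y pD]]] := hP p (p ∘ m).
have [N [u [v pN]]] := hP (p ∘ m) (p ∘ m).
(* [h] embeds the kernel pair [N] of [p ∘ m] into [D] over [M]; it contains a section of [y] and the
   kernel of [y]. *)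
have [|h [xh yh]] := pullback_lift pD (x := m ∘ u) (y := v).
  by rewrite compA pN.1.
have hm : is_mono h.
  move=> T r t e; apply: (pullback_uniq pN); last by rewrite -yh -!compA e.
  by apply: mm; rewrite !compA -xh -!compA e.
have [|s [us vs]] := pullback_lift pN (x := idm M) (y := idm M) => //.
have [k2 [xk yk]] := pullback_kernel_lift pD pC kK.
have k2K := pullback_kernel pD kK xk yk.
have [|k3 [uk vk]] := pullback_lift pN (x := k') (y := y ∘ k2).
  by rewrite -compA mk; apply: zero_uniq; [exact: kK.1 | apply: zero_compl].
have hI : is_iso h.
  apply: (split_epi_kernel_section_iso (s := h ∘ s) _ k2K hm (k' := k3)) => //.
    by rewrite compA yh.
  apply: (pullback_uniq pD); first by rewrite compA xh -compA uk mk.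
  by rewrite compA yh.
have [h' [_ hh']] := hI.
(* As [h] is invertible, the regular epimorphism [x] factors through [m]. *)
have xR := regular_epi_pullback (pullback_sym pD) pmR.
apply: (regular_epi_extremal xR (g := u ∘ h')) => //.
by rewrite compA -xh -compA hh' compm1.
Qed.

End Category.

(** * Nullification *)

Section Nullification.
Variables (C : category) (A : C) (R : nullification A).
Hypothesis saC : semi_abelian C.
Implicit Types X Y Z T : C.

Let pC : pointed C.
Proof. by case: saC. Qed.

Let regC : regular_category C.
Proof. by case: saC => _ _ [] . Qed.

Let hP : has_pullbacks C.
Proof. by case: regC => -[]. Qed.

Let protC : protomodular C.
Proof. by case: saC. Qed.

Local Notation L := (localization R).

Lemma null_L X : is_null A (L X).
Proof. exact: proj2_sig (refl R X). Qed.

Arguments null_L : clear implicits.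

Lemma eta_nat X Y (f : hom X Y) : fmap L f ∘ eta R X = eta R Y ∘ f.
Proof. exact: eta_natural. Qed.

Lemma eta_lift X Z (f : hom X Z) : is_null A Z ->
  exists g : hom (L X) Z, g ∘ eta R X = f.
Proof.
by move=> nZ; have [g [e _]] := eta_universal R (Z := exist _ Z nZ) f; exists g.
Qed.

Lemma eta_uniq X Z (f g : hom (L X) Z) : is_null A Z ->
  f ∘ eta R X = g ∘ eta R X -> f = g.
Proof.
move=> nZ e.
exact: exists_uniq (eta_universal R (Z := exist _ Z nZ) (g ∘ eta R X)) e erefl.
Qed.

(** * Closure properties of null objects *)

Lemma null_mono X Y (m : hom X Y) : is_mono m -> is_null A Y -> is_null A X.
Proof. by move=> mm nY f; apply: mono_zero mm (nY _). Qed.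

Lemma null_extension K E Q (i : hom K E) (p : hom E Q) :
  is_kernel i p -> is_null A K -> is_null A Q -> is_null A E.
Proof.
move=> [_ U] nK nQ f; have [u [<- _]] := U _ f (nQ _).
exact: zero_compl.
Qed.

Lemma null_pullback W X Y Z (a : hom W X) (b : hom W Y) (f : hom X Z) (g : hom Y Z) :
  is_pullback a b f g -> is_null A X -> is_null A Y -> is_null A W.
Proof.
move=> pb nX nY h; have [z z0] := zero_exists A W pC.
rewrite (_ : h = z) //.
by apply: (pullback_uniq pb); apply: zero_uniq => //; apply: zero_compl.
Qed.

(** A subobject of [L X] through which [eta R X] factors is null, so universality splits its
    inclusion. *)
Lemma eta_regular_epi X : is_regular_epi (eta R X).
Proof.
apply: extremal_epi_regular => // I m g mm e.
have [r re] := eta_lift g (null_mono mm (null_L X)).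
apply: (mono_retraction_iso mm (r := r)).
by apply: eta_uniq; [exact: null_L | rewrite -compA re -e comp1m].
Qed.

(** * Local equivalences: the morphisms inverted by [L], via orthogonality to null objects *)

Definition local_equivalence X Y (c : hom X Y) : Prop :=
  forall Z, is_null A Z -> forall f : hom X Z, exists! g : hom Y Z, g ∘ c = f.

(** Amounts to [L T] being a zero object. *)
Definition acyclic T : Prop := forall Z, is_null A Z -> forall f : hom T Z, is_zero f.

Lemma local_equivalence_eta X : local_equivalence (eta R X).
Proof.
move=> Z nZ f; have [g e] := eta_lift f nZ; exists g; split=> // h eh.
by apply: eta_uniq => //; rewrite e eh.
Qed.

Lemma local_equivalence_comp X Y Z (d : hom Y Z) (c : hom X Y) :
  local_equivalence d -> local_equivalence c -> local_equivalence (d ∘ c).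
Proof.
move=> dL cL T nT f; have [g [gc gU]] := cL _ nT f.
have [h [hd hU]] := dL _ nT g; exists h; split; first by rewrite compA hd.
by move=> h' e; apply: hU; rewrite (gU (h' ∘ d)) // -compA.
Qed.

Lemma local_equivalence_iso X Y (c : hom X Y) :
  local_equivalence c -> is_iso (fmap L c).
Proof.
(* Extending [eta R X] along [c], then along [eta R Y], yields the inverse [h : L Y -> L X]. *)
move=> cL; have [g [gc _]] := cL _ (null_L X) (eta R X).
have [h hg] := eta_lift g (null_L X); exists h; split; apply: eta_uniq; try exact: null_L.
  by rewrite comp1m -compA eta_nat compA hg.
rewrite comp1m -compA hg.
apply: (exists_uniq (cL _ (null_L Y) (eta R Y ∘ c))) => //.
by rewrite -compA gc eta_nat.
Qed.

Lemma iso_local_equivalence X Y (c : hom X Y) :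
  is_iso (fmap L c) -> local_equivalence c.
Proof.
move=> [h [hc ch]] Z nZ f; have [g ge] := eta_lift f nZ.
exists (g ∘ h ∘ eta R Y); split.
  by rewrite -(compA (g ∘ h)) -eta_nat compA -(compA g) hc compm1.
move=> k kc; have [k' ke] := eta_lift k nZ; rewrite -ke; congr (_ ∘ _).
suff <- : k' ∘ fmap L c = g by rewrite -compA ch compm1.
by apply: eta_uniq => //; rewrite -compA eta_nat compA ke kc ge.
Qed.

(** Maps into a null object vanish on the kernel, hence factor uniquely through [c], its
    cokernel. *)
Lemma local_equivalence_acyclic_kernel T X Y (c : hom X Y) (k : hom T X) :
  is_regular_epi c -> is_kernel k c -> acyclic T -> local_equivalence c.
Proof.
move=> cR kK aT Z nZ f.
have [_] := regular_epi_cokernel regC pC protC cR kK; apply.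
exact: aT.
Qed.

(** [V] is null as a pullback of null objects, so the local equivalence [c] identifies it with
    [L W]. *)
Lemma local_equivalence_null_pullback W X Y Z V (a : hom W X) (b : hom W Y)
    (f : hom X Z) (g : hom Y Z) (v1 : hom V (L X)) (v2 : hom V (L Y)) (c : hom W V) :
  is_pullback v1 v2 (fmap L f) (fmap L g) -> local_equivalence c ->
  v1 ∘ c = eta R X ∘ a -> v2 ∘ c = eta R Y ∘ b ->
  is_pullback (fmap L a) (fmap L b) (fmap L f) (fmap L g).
Proof.
move=> pV cL e1 e2; have nV := null_pullback pV (null_L X) (null_L Y).
have [h he] := eta_lift c nV.
have hI : is_iso h.
  have [k [kc kU]] := cL _ (null_L W) (eta R W); exists k; split.
    by apply: eta_uniq; [exact: null_L | rewrite comp1m -compA he].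
  apply: (exists_uniq (cL _ nV c)); last by rewrite comp1m.
  by rewrite -compA kc.
suff [<- <-] : v1 ∘ h = fmap L a /\ v2 ∘ h = fmap L b by apply: pullback_iso.
by split; apply: eta_uniq; try exact: null_L; rewrite -compA he eta_nat.
Qed.

(** * Acyclic kernels and semi-left-exactness *)

Hypothesis fl : forall (K E Q : C) (x : extension K E Q),
  inhabited (fiberwise_localization R x).

(* The fiberwise localization of T -> X -> L X has a null total object, being
   an extension of null objects; it is thus L X itself, and L T = 0. *)
Lemma eta_kernel_acyclic X T (k : hom T X) : is_kernel k (eta R X) -> acyclic T.
Proof.
move=> kK.
have ex := regular_epi_short_exact regC pC protC (eta_regular_epi X) kK.
have [[E [i p [iK _]] /= e eI [_ /= pe]]] := fl (Extension ex).
rewrite comp1m in pe.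
have nE := null_extension iK (null_L T) (null_L X).
have [r re] := eta_lift e nE.
(* [e] is a local equivalence into a null object, so [r ∘ p ∘ e = e] suffices. Then [p] is monic,
   and its kernel [i], itself monic, is zero. *)
have rp : r ∘ p = idm E.
  apply: (exists_uniq (iso_local_equivalence eI nE e)).
    by rewrite -compA -pe re.
  by rewrite comp1m.
have i0 : is_zero i.
  by rewrite -(comp1m i) -rp -compA; apply: zero_compl; exact: iK.1.
have id0 : is_zero (idm (L T)).
  by apply: (mono_zero pC (kernel_mono iK)); rewrite compm1.
move=> Z nZ f; have [g <-] := eta_lift f nZ.
by rewrite -(compm1 g); apply: zero_compr; apply: zero_compl.
Qed.

(** [b] inherits from [eta R X] both regularity and the acyclic kernel. *)
Lemma eta_pullback_local_equivalence W X Y (a : hom W X) (b : hom W Y)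
    (g : hom Y (L X)) :
  is_pullback a b (eta R X) g -> local_equivalence b.
Proof.
move=> pb; have [T [k kK]] := kernel_exists (eta R X) pC hP.
have [k' [ak bk]] := pullback_kernel_lift pb pC kK.
apply: (local_equivalence_acyclic_kernel (k := k')).
- exact: regular_epi_pullback pb (eta_regular_epi X).
- exact: (pullback_kernel pb kK ak bk).
- exact: eta_kernel_acyclic kK.
Qed.

Lemma nullification_semi_left_exact : semi_left_exact R.
Proof.
(* A commutative square with two opposite sides invertible is a pullback; here these are the images
   of [b] and [eta R X]. *)
move=> X E x W a b pb; apply: iso_pullback.
- by rewrite -!fmapM pb.1.
- exact: local_equivalence_iso (eta_pullback_local_equivalence pb).
- exact: local_equivalence_iso (@local_equivalence_eta X).
Qed.

(** * Pullbacks of flat extensions *)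

Section Flat.
Variables (K E Q : C) (i : hom K E) (p : hom E Q).
Hypotheses (ip : is_short_exact i p) (Lip : is_short_exact (fmap L i) (fmap L p)).
(** [c] compares [E] with the pullback of [L E] along [eta R Q]; it will be a regular epimorphism
    with acyclic kernel. *)
Variables (P : C) (pE : hom P (L E)) (pQ : hom P Q) (c : hom E P).
Hypothesis pP : is_pullback pE pQ (fmap L p) (eta R Q).
Hypotheses (pEc : pE ∘ c = eta R E) (pQc : pQ ∘ c = p).

(** A subobject [m] through which [c] factors contains the kernel [L K] of [pQ], since [eta R K] is
    a regular epimorphism, and it covers [Q], since [p] does; so it is all of [P]. *)
Lemma flat_comparison_regular_epi : is_regular_epi c.
Proof.
apply: extremal_epi_regular => // I m q mm e.
have [j [pEj pQj]] := pullback_kernel_lift pP pC Lip.1.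
have jK := pullback_kernel pP Lip.1 pEj pQj.
have ci : c ∘ i = j ∘ eta R K.
  apply: (pullback_uniq pP); first by rewrite !compA pEc pEj eta_nat.
  rewrite !compA pQc; apply: zero_uniq; first exact: ip.1.1.
  exact: zero_compr.
have [|j' mj] := regular_epi_lift (eta_regular_epi K) mm (x := q ∘ i) (y := j).
  by rewrite compA -e.
apply: (mono_kernel_iso regC pC protC jK mm _ mj).
apply: (regular_epi_compr regC (f := q)).
by rewrite -compA -e pQc; apply: cokernel_regular_epi pC ip.2.
Qed.

(** A map killed by [c] is killed by [p], so it comes from [K]; there [eta R K] kills it because
    [fmap L i] is monic. *)
Lemma flat_comparison_kernel T (t : hom T K) :
  is_kernel t (eta R K) -> is_kernel (i ∘ t) c.
Proof.
move=> tK; have im := kernel_mono ip.1; have Lim := kernel_mono Lip.1.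
split.
  have [z z0] := zero_exists T P pC; rewrite (_ : _ ∘ _ = z) //.
  apply: (pullback_uniq pP); apply: zero_uniq; try exact: zero_compl.
    rewrite !compA pEc -eta_nat -compA; apply: zero_compl; exact: tK.1.
  by rewrite !compA pQc; apply: zero_compr; exact: ip.1.1.
move=> S x cx; have [|y [iy _]] := ip.1.2 _ x.
  by rewrite -pQc -compA; apply: zero_compl.
have [|u [tu _]] := tK.2 _ y.
  apply: (mono_zero pC Lim).
  by rewrite compA eta_nat -compA iy -pEc -compA; apply: zero_compl.
exists u; split; first by rewrite -compA tu.
move=> v iv; apply: (kernel_mono tK); apply: im.
by rewrite tu iy -iv compA.
Qed.

(* The pullback W of p along g maps to V = L E ×_(L Q) L X through
   W' = X ×_(L X) V, and W -> W' is a pullback of c. *)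
Lemma flat_pullback W X (g : hom X Q) (a : hom W E) (b : hom W X) :
  is_pullback a b p g -> is_pullback (fmap L a) (fmap L b) (fmap L p) (fmap L g).
Proof.
move=> pW.
have [V [v1 [v2 pV]]] := hP (fmap L p) (fmap L g).
have [W' [w2 [w1 pW']]] := hP (eta R X) v2.
have [|s [v1s v2s]] := pullback_lift pV (x := eta R E ∘ a) (y := eta R X ∘ b).
  by rewrite !compA !eta_nat -!compA pW.1.
have [|d [w2d w1d]] := pullback_lift pW' (x := b) (y := s) => //.
(* [y : W' -> P] is the map along which [d] is the base change of [c]. *)
have [|y [pEy pQy]] := pullback_lift pP (x := v1 ∘ w1) (y := g ∘ w2).
  by rewrite !compA pV.1 -eta_nat -!compA pW'.1.
have pd : is_pullback a d c y.
  split.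
    apply: (pullback_uniq pP); first by rewrite !compA pEc pEy -compA w1d.
    by rewrite !compA pQc pQy pW.1 -compA w2d.
  move=> T x z e.
  have [|u [au bu]] := pullback_lift pW (x := x) (y := w2 ∘ z).
    by rewrite compA -pQy -pQc -!compA e.
  exists u; split.
    split=> //; apply: (pullback_uniq pW'); first by rewrite compA w2d.
    rewrite compA w1d; apply: (pullback_uniq pV); rewrite !compA.
      by rewrite v1s -pEy -(compA pE) -e -compA au compA pEc.
    by rewrite v2s -pW'.1 -!compA bu.
  move=> u' [au' du']; apply: (pullback_uniq pW); first by rewrite au.
  by rewrite bu -w2d -du' compA.
have [T [t tK]] := kernel_exists (eta R K) pC hP.
have kK := flat_comparison_kernel tK.
have [k [ak dk]] := pullback_kernel_lift pd pC kK.
have dL : local_equivalence d.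
  apply: (local_equivalence_acyclic_kernel (k := k)).
  - exact: regular_epi_pullback pd flat_comparison_regular_epi.
  - exact: (pullback_kernel pd kK ak dk).
  - exact: eta_kernel_acyclic tK.
(* [w1] is a base change of [eta R X], so the map [w1 ∘ d] from [W] to the null object [V] is a
   local equivalence. *)
have w1L := eta_pullback_local_equivalence pW'.
apply: (local_equivalence_null_pullback pV (local_equivalence_comp w1L dL)).
  by rewrite w1d.
by rewrite w1d.
Qed.

End Flat.

Lemma nullification_conditionally_flat : conditionally_flat R.
Proof.
move=> K E Q i p [ip Lip] X g W a b i' pW ai bi; split.
  exact: (pullback_short_exact regC pC protC pW ip).
have [P [pE [pQ pP]]] := hP (fmap L p) (eta R Q).
have [c [pEc pQc]] := pullback_lift pP (eta_nat p).
have LpW := flat_pullback ip Lip pP pEc pQc pW.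
apply: (pullback_short_exact regC pC protC LpW Lip).
  by rewrite -ai fmapM.
(* [fmap L (b ∘ i')] and a zero map [w] both restrict along [eta R K] to a zero map, hence both
   equal [y]. *)
have [z z0] := zero_exists K (L X) pC.
have [y [ye _]] := local_equivalence_eta (null_L X) z.
rewrite -fmapM (_ : fmap L (b ∘ i') = y).
  have [w w0] := zero_exists (L K) (L X) pC.
  suff -> : y = w by [].
  apply: eta_uniq; first exact: null_L.
  by apply: zero_uniq; [rewrite ye | apply: zero_compr].
apply: eta_uniq; first exact: null_L.
by rewrite ye eta_nat; apply: zero_uniq => //; apply: zero_compl.
Qed.

End Nullification.

Theorem corollary7p2 (S : signature) (Th : identities S)
    (A : variety Th) (PA : nullification A) :
  semi_abelian (variety Th) ->
  admits_functorial_fiberwise_localization PA ->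
  semi_left_exact PA /\ conditionally_flat PA.
Proof.
move=> saC [F].
have fl K E Q (x : extension K E Q) : inhabited (fiberwise_localization PA x).
  by split; exact: ffl F _ _ _ x.
split.
  exact: (nullification_semi_left_exact saC fl).
exact: (nullification_conditionally_flat saC fl).
Qed.
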